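(* Let $n\ge 1$, and let $(v_r)_{r\in R}$, $(w_r)_{r\in R}$, $c$ be an evaluation scheme of order $n$ (so $R$ is finite, $v_r=(v_{r,0},\dots,v_{r,n-1})\in\mathbb{C}^n$, $w_r\in\mathbb{C}$, $c\in\mathbb{C}$), with transform sum $T[B]$. For each multiplicity vector $k=(k_0,\dots,k_{n-1})\in\mathbb{Z}_{\ge 0}^{\,n}$ with $|k|=n$ put $$\Phi(k)=c\sum_{r\in R} w_r\prod_{j=0}^{n-1} v_{r,j}^{\,k_j}\qquad(\text{with } t^0:=1).$$ Then $T[B]=\operatorname{per} B$ for every $B\in\mathbb{C}^{n\times n}$ if and only if $\Phi(k)=[\,k=\mathbf 1\,]$ for all $k\in\mathbb{Z}_{\ge 0}^{\,n}$ with $|k|=n$.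
   Context: Matrices $B=(b_{ij})\in\mathbb{C}^{n\times n}$ have rows indexed by $i=1,\dots,n$ and columns indexed by $j=0,\dots,n-1$. The permanent is $\operatorname{per} B=\sum_{\sigma}\prod_{i=1}^n b_{i\sigma(i)}$, the sum being over all bijections $\sigma:\{1,\dots,n\}\to\{0,\dots,n-1\}$. An evaluation scheme of order $n$ is a finite family of vectors $v_r\in\mathbb{C}^n$ ($r\in R$) with weights $w_r\in\mathbb{C}$ and a constant $c\in\mathbb{C}$. Its transform sum is $$T[B]=c\sum_{r\in R} w_r\prod_{i=1}^n\Bigl(\sum_{j=0}^{n-1} b_{ij}v_{r,j}\Bigr),\qquad B\in\mathbb{C}^{n\times n}.$$ For $k\in\mathbb{Z}_{\ge0}^{\,n}$, $|k|=\sum_{j} k_j$; $\mathbf 1=(1,\dots,1)$; and $[\,\cdot\,]$ is the Iverson bracket ($1$ if the condition holds, $0$ otherwise). The convention $t^0=1$ applies also for $t=0$. *)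

(* Defs.v *)
From mathcomp Require Import all_boot all_order all_fingroup all_algebra.
From mathcomp Require Import reals.
From mathcomp.real_closed Require Import complex.

Set Implicit Arguments.
Unset Strict Implicit.
Unset Printing Implicit Defensive.

Import GRing.Theory.
Local Open Scope ring_scope.

(* Rows and columns are both indexed by 'I_n = {0, ..., n-1}: the i-th row, for
   1 <= i <= n, has index i - 1, so the bijections from rows to columns are the
   permutations of 'I_n. *)
Definition permanent (C : comNzRingType) (n : nat) (B : 'M[C]_n) : C :=
  \sum_(s : 'S_n) \prod_(i < n) B i (s i).

(* An evaluation scheme of order n is given by a finite index type I, vectors v,
   weights w and a constant c. *)
Definition transform_sum (C : comNzRingType) (n : nat) (I : finType)
    (v : I -> 'rV[C]_n) (w : I -> C) (c : C) (B : 'M[C]_n) : C :=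
  c * \sum_(r : I) w r * \prod_(i < n) (\sum_(j < n) B i j * v r 0 j).

(* The convention 0 ^ 0 = 1 is that of ^+. *)
Definition scheme_moment (C : comNzRingType) (n : nat) (I : finType)
    (v : I -> 'rV[C]_n) (w : I -> C) (c : C) (k : {ffun 'I_n -> nat}) : C :=
  c * \sum_(r : I) w r * \prod_(j < n) v r 0 j ^+ k j.

(* Main.v *)
(* Expanding the product over the rows, T[B] is the sum over all maps f from
   rows to columns of Phi(k_f) * prod_i b_{i,f(i)}, where k_f(j) is the size of
   the fibre of f over j, and per B is the same sum restricted to injective f,
   i.e. to those with k_f = 1. This settles one direction. Conversely, every k
   with |k| = n is some k_f, and for the 0/1 matrix of the graph of f the
   identity T[B] = per B reads Phi(k) = [f is injective]. *)
Require Import Defs.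
From mathcomp Require Import all_boot all_order all_fingroup all_algebra.
From mathcomp Require Import reals.
From mathcomp.real_closed Require Import complex.

Set Implicit Arguments.
Unset Strict Implicit.
Unset Printing Implicit Defensive.

Import GRing.Theory.
Local Open Scope ring_scope.
Local Open Scope complex_scope.

Definition fiber_card (T : finType) (f : {ffun T -> T}) : {ffun T -> nat} :=
  [ffun j => #|[pred i | f i == j]|].

Lemma sum_fiber_card (T : finType) (f : {ffun T -> T}) :
  (\sum_j fiber_card f j)%N = #|T|.
Proof.
rewrite -sum1_card [RHS](partition_big f predT) //=.
by apply: eq_bigr => j _; rewrite ffunE -sum1_card.
Qed.

Lemma prod_fiber_card (C : comNzRingType) (T : finType) (f : {ffun T -> T})
    (x : T -> C) :
  \prod_i x (f i) = \prod_j x j ^+ fiber_card f j.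
Proof.
rewrite [LHS](partition_big f predT) //=; apply: eq_bigr => j _.
rewrite ffunE -prodr_const; apply: congr_big => // i /eqP <- //.
Qed.

(** Two points with the same image lie in one fibre, which has a single element. Conversely, an
    injective self-map of a finite type is bijective, so the fibre over [j] is exactly
    [invF inj_f j]. *)
Lemma fiber_card_eq1 (T : finType) (f : {ffun T -> T}) :
  (fiber_card f == [ffun=> 1%N]) = injectiveb f.
Proof.
apply/eqP/injectiveP => [f1 i i' eq_f | inj_f].
  have /eqP/card1P[i0 fi0] : #|[pred l | f l == f i]| = 1%N.
    by move/ffunP/(_ (f i)): f1; rewrite !ffunE.
  move: (fi0 i) (fi0 i'); rewrite !inE eq_f eqxx.
  by move=> /esym/eqP-> /esym/eqP->.
apply/ffunP => j; rewrite !ffunE -(f_invF inj_f j).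
by rewrite -(card1 (invF inj_f j)); apply: eq_card => i; rewrite !inE inj_eq.
Qed.

(** The word [s] that repeats each letter [j] exactly [k j] times has length [n]. Read as a map from
    positions to letters, it has the prescribed fibres. *)
Lemma fiber_card_surj (n : nat) (k : {ffun 'I_n -> nat}) :
  (\sum_j k j)%N = n -> exists f : {ffun 'I_n -> 'I_n}, fiber_card f = k.
Proof.
move=> sum_k; pose s := flatten [seq nseq (k j) j | j <- enum 'I_n].
have size_s : size s == n.
  rewrite size_flatten /shape -map_comp sumnE big_map big_enum /=.
  by rewrite -[X in _ == X]sum_k; apply/eqP/eq_bigr => j _; rewrite size_nseq.
exists [ffun i => tnth (Tuple size_s) i]; apply/ffunP => j; rewrite ffunE.
have -> : k j = count_mem j s.
  rewrite count_flatten -map_comp sumnE big_map big_enum /= (bigD1 j) //=.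
  rewrite count_nseq /= eqxx mul1n big1 ?addn0 // => l /negPf l_neq.
  by rewrite count_nseq /= l_neq.
(* Occurrences of [j] in [s] become positions [i] whose letter is [j], that is, the fibre over
   [j]. *)
rewrite -[s]/(tval (Tuple size_s)) -[in RHS](map_tnth_enum (Tuple size_s)).
rewrite count_map -size_filter cardE enumT /= /enum_mem.
by congr size; rewrite -enumT; apply: eq_filter => i; rewrite !inE ffunE.
Qed.

Lemma transform_sum_expand (C : comNzRingType) (n : nat) (I : finType)
    (v : I -> 'rV[C]_n) (w : I -> C) (c : C) (B : 'M[C]_n) :
  transform_sum v w c B = \sum_(f : {ffun 'I_n -> 'I_n})
    scheme_moment v w c (fiber_card f) * \prod_i B i (f i).
Proof.
rewrite /transform_sum /scheme_moment.
under eq_bigr => r _ do rewrite bigA_distr_bigA mulr_sumr.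
rewrite exchange_big mulr_sumr; apply: eq_bigr => f _.
rewrite -mulrA mulr_suml; congr (_ * _); apply: eq_bigr => r _.
by rewrite -prod_fiber_card big_split /= -mulrA; congr (_ * _); rewrite mulrC.
Qed.

Lemma permanent_sum_injective (C : comNzRingType) (n : nat) (B : 'M[C]_n) :
  permanent B =
    \sum_(f : {ffun 'I_n -> 'I_n}) (injectiveb f)%:R * \prod_i B i (f i).
Proof.
rewrite [RHS](bigID (fun f : {ffun 'I_n -> 'I_n} => injectiveb f)) /=.
rewrite [X in _ + X]big1 ?addr0; last first.
  by move=> f /negPf->; rewrite mul0r.
rewrite (reindex (@pval _)) /=; last first.
  (* The identity is the default value of [insubd], which inverts [pval] on the injective maps. *)
  have pT : {perm 'I_n} := 1%g.
  by exists (insubd pT) => f inj_f;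
    [exact/val_inj/insubdK/valP | exact: insubdK].
apply: eq_big => [s | s _]; first exact/esym/(valP s).
by rewrite (valP s) mul1r; apply: eq_bigr => i _; rewrite pvalE.
Qed.

Lemma prod_graph (C : comNzRingType) (n : nat) (f g : {ffun 'I_n -> 'I_n}) :
  \prod_i (\matrix_(i, j) (f i == j)%:R : 'M[C]_n) i (g i) = (g == f)%:R.
Proof.
case: eqP => [-> | neq_gf]; first by rewrite big1 // => i _; rewrite mxE eqxx.
have [i fgi | eq_fg] := pickP (fun i => f i != g i).
  by rewrite (bigD1 i) //= mxE (negPf fgi) mul0r.
by case: neq_gf; apply/ffunP => i; apply/esym/eqP/negbFE/eq_fg.
Qed.

(** The graph matrix of [f] isolates one coefficient of an expansion over maps: any [g] other than
    [f] meets a zero entry. *)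
Lemma sum_prod_graph (C : comNzRingType) (n : nat) (f : {ffun 'I_n -> 'I_n})
    (a : {ffun 'I_n -> 'I_n} -> C) :
  \sum_g a g * \prod_i (\matrix_(i, j) (f i == j)%:R : 'M[C]_n) i (g i) = a f.
Proof.
rewrite (bigD1 f) //= prod_graph eqxx mulr1 big1 ?addr0 // => g /negPf neq_gf.
by rewrite prod_graph neq_gf mulr0.
Qed.

Theorem proposition1 (R : realType) (n : nat) (hn : (1 <= n)%N)
    (I : finType) (v : I -> 'rV[R[i]]_n) (w : I -> R[i]) (c : R[i]) :
  (forall B : 'M[R[i]]_n, transform_sum v w c B = permanent B) <->
  (forall k : {ffun 'I_n -> nat}, (\sum_(j < n) k j)%N = n ->
     scheme_moment v w c k = (k == [ffun=> 1%N])%:R).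
Proof.
split=> [perT k /fiber_card_surj[f <-] | Phi1 B].
  have := perT (\matrix_(i, j) (f i == j)%:R).
  rewrite transform_sum_expand permanent_sum_injective.
  (* Extracting the coefficient of [f] on both sides leaves the moment on the left and the
     injectivity indicator on the right. *)
  by rewrite (sum_prod_graph _ (fun g => scheme_moment v w c (fiber_card g)))
    (sum_prod_graph _ (fun g => (injectiveb g)%:R)) fiber_card_eq1.
rewrite transform_sum_expand permanent_sum_injective; apply: eq_bigr => f _.
by rewrite Phi1 ?fiber_card_eq1 // sum_fiber_card card_ord.
Qed.
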